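(* Let $\mathsf{C}\subset V$ be a proper cone, $\phi$ in the interior of $\mathsf{C}^*$, $k\ge1$ an integer, and $K_\phi=\mathsf{C}\cap\phi^{-1}(1)$. The following are equivalent: (i) the $k$th reduction map $\gamma_k^\phi$ is entanglement-breaking; (ii) $K_\phi$ is affinely isomorphic to the Cartesian product of at most $k$ simplices.
   Context: A convex cone in a finite-dimensional real vector space is proper if it is closed, contains no line, and is not contained in any hyperplane; $\mathsf{C}^*=\{f\in V^*: f\ge0 \text{ on }\mathsf{C}\}$. Minimal tensor product: $\mathsf{C}_1\otimes_{\min}\mathsf{C}_2=\mathrm{conv}\{x\otimes y:x\in\mathsf{C}_1,y\in\mathsf{C}_2\}$, iterated as $\mathsf{C}^{\otimes_{\min}k}$. The $k$th reduction map $\gamma_k^\phi=\frac1k\sum_{j=1}^k \phi^{\otimes(j-1)}\otimes\mathrm{Id}_V\otimes\phi^{\otimes(k-j)}:V^{\otimes k}\to V$ is viewed as a tensor in $(V^* )^{\otimes k}\otimes V$ (identifying $(V^{\otimes k})^*$ with $(V^* )^{\otimes k}$), namely the unique tensor with $\langle\gamma_k^\phi, x_1\otimes\cdots\otimes x_k\otimes\psi\rangle=\frac{\psi(x_1)+\dots+\psi(x_k)}{k}$ for $x_i\in K_\phi$, $\psi\in V^*$. It is called entanglement-breaking if this tensor belongs to $(\mathsf{C}^* )^{\otimes_{\min}k}\otimes_{\min}\mathsf{C}$. *)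

(* Defs.v *)
From HB Require Import structures.
From mathcomp Require Import all_boot all_order all_algebra.
From mathcomp Require Import all_classical all_reals all_analysis.
Set Implicit Arguments. Unset Strict Implicit. Unset Printing Implicit Defensive.
Import Order.TTheory GRing.Theory Num.Theory.
Import numFieldNormedType.Exports.
Local Open Scope classical_set_scope.
Local Open Scope ring_scope.

(* V = R^n modelled as row vectors 'rV[R]_n; V^* is identified with R^n
   through the standard pairing [dotv f x]. *)
Definition dotv (R : realType) (n : nat) (f x : 'rV[R]_n) : R :=
  \sum_(i < n) f 0 i * x 0 i.

Definition proper_cone (R : realType) (n : nat) (C : set 'rV[R]_n) : Prop :=
  [/\ C 0 /\ (forall x y, C x -> C y -> C (x + y)),
      (forall (t : R) x, 0 <= t -> C x -> C (t *: x)),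
      closed C,
      (forall x, C x -> C (- x) -> x = 0)
    & (forall f : 'rV[R]_n, f != 0 -> exists x, C x /\ dotv f x != 0)].

Definition dual_cone (R : realType) (n : nat) (C : set 'rV[R]_n) : set 'rV[R]_n :=
  fun f => forall x, C x -> 0 <= dotv f x.

Definition base_K (R : realType) (n : nat) (C : set 'rV[R]_n) (phi : 'rV[R]_n)
  : set 'rV[R]_n := fun x => C x /\ dotv phi x = 1.

(* Elements of (V^* )^{⊗k} ⊗ V, given by their coefficients in the basis
   e_{idx 0}^* ⊗ ... ⊗ e_{idx (k-1)}^* ⊗ e_i. *)
Definition tensorT (R : realType) (n k : nat) : Type :=
  {ffun 'I_k -> 'I_n} -> 'I_n -> R.

Definition min_tensor_cone (R : realType) (n k : nat) (D C : set 'rV[R]_n)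
  : set (tensorT R n k) :=
  fun T => exists (m : nat) (lam : 'I_m -> R) (f : 'I_m -> 'I_k -> 'rV[R]_n)
                  (x : 'I_m -> 'rV[R]_n),
    [/\ (forall j, 0 <= lam j), \sum_(j < m) lam j = 1,
        (forall j l, D (f j l)), (forall j, C (x j))
      & forall idx i, T idx i =
          \sum_(j < m) lam j * ((\prod_(l < k) f j l 0 (idx l)) * x j 0 i)].

(* gamma_k^phi = 1/k sum_j phi^{⊗(j-1)} ⊗ Id_V ⊗ phi^{⊗(k-j)}, where
   Id_V = sum_i e_i^* ⊗ e_i sits in slot j and in the final V slot. *)
Definition reduction_tensor (R : realType) (n k : nat) (phi : 'rV[R]_n)
  : tensorT R n k :=
  fun idx i => (k%:R)^-1 *
    \sum_(j < k) ((idx j == i)%:R * \prod_(l < k | l != j) phi 0 (idx l)).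

Definition entanglement_breaking (R : realType) (n k : nat)
  (C : set 'rV[R]_n) (phi : 'rV[R]_n) : Prop :=
  @min_tensor_cone R n k (dual_cone C) C (@reduction_tensor R n k phi).

(* Δ_{d 0} × ... × Δ_{d (m-1)}, Δ_d the standard d-simplex in R^{d+1};
   realised in R^{sum_i (d i + 1)} indexed by the sigma type. *)
Definition simplex_prod (R : realType) (m : nat) (d : 'I_m -> nat)
  : set {ffun {i : 'I_m & 'I_(d i).+1} -> R} :=
  fun p => (forall t, 0 <= p t) /\
    forall i : 'I_m, \sum_(j < (d i).+1) p (Tagged (fun i => 'I_(d i).+1) j) = 1.

Definition affinely_isomorphic (R : realType) (U W : lmodType R)
  (A : set U) (B : set W) : Prop :=
  exists f : U -> W,
    [/\ (forall x, A x -> B (f x)),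
        (forall x y, A x -> A y -> f x = f y -> x = y),
        (forall y, B y -> exists x, A x /\ f x = y)
      & (forall x y (t : R), A x -> A y -> 0 <= t -> t <= 1 ->
           f (t *: x + (1 - t) *: y) = t *: f x + (1 - t) *: f y)].

(* Main.v *)
Require Import Defs.
From HB Require Import structures.
From mathcomp Require Import all_boot all_order all_algebra.
From mathcomp Require Import all_classical all_reals all_analysis.
From mathcomp Require Import ring lra.
Import Order.TTheory GRing.Theory Num.Theory.
Import numFieldNormedType.Exports.
Set Implicit Arguments. Unset Strict Implicit. Unset Printing Implicit Defensive.
Local Open Scope classical_set_scope.
Local Open Scope ring_scope.

(** From simplices to a decomposition: given points [x_1, ..., x_k] of a product
of at most [k] simplices (padded by points to exactly [k] factors), assign the
points to the factors by a random cyclic shift, measure in each factor the vertex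
of the point assigned to it and output the product of the vertices found. Each
point is measured once, and the expected output is the mean of the points.

From a decomposition [sum_j prod_l f_jl(x_l) y_j] of the mean to simplices: the
[f_jl] cut out [C], so an irredundant subfamily provides the facets [F_a]. If
[F_a(y_j) <> 0], evaluating on the facet [a] shows that some [f_jl] is a multiple
of [F_a], so every facet missing [y_j] occupies a slot [l] of its own. Let [v] be
a point of [C] with minimal support [S = {a | F_a(v) <> 0}]; then [#|S| <= k].
For [a] outside [S], the arguments [(e, v, ..., v)] produce an edge at [v] leaving
the facet [a]; let [w_a] be its endpoint. On the span of [v] and [w_a] every
surviving term has all facets of [S] among its factors. Let [beta a] be a facet of
[S] containing [w_a]. Evaluating [F_(beta a)] at [(v, w_a, ..., w_a)] and at a zero
of [F_c] on the diagonal shows that [F_c(w_a) = F_c(v)] for the other [c] in [S].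
Hence [phi = F_b / F_b(v) + sum_(beta a = b) F_a / F_a(w_a)] for each [b] in [S],
which exhibits [K] as a product of [#|S|] simplices. *)

(** * The standard pairing as a linear form *)

Lemma dotvC (R : realType) n (f x : 'rV[R]_n) : dotv f x = dotv x f.
Proof. by apply: eq_bigr => i _; rewrite mulrC. Qed.

Lemma dotv_is_linear (R : realType) n (f : 'rV[R]_n) : linear_for *%R (dotv f).
Proof.
move=> a x y; rewrite /dotv mulr_sumr -big_split; apply: eq_bigr => i _ /=.
by rewrite !mxE; ring.
Qed.

HB.instance Definition _ (R : realType) n (f : 'rV[R]_n) :=
  GRing.isLinear.Build R 'rV[R]_n R *%R (dotv f) (dotv_is_linear f).

Lemma dotv_delta (R : realType) n (f : 'rV[R]_n) i : dotv f (delta_mx 0 i) = f 0 i.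
Proof.
rewrite /dotv (bigD1 i) //= big1 => [|j ne_ji]; rewrite !mxE eqxx.
  by rewrite eqxx mulr1 addr0.
by rewrite (negPf ne_ji) mulr0.
Qed.

Lemma dotv_eq (R : realType) n (f g : 'rV[R]_n) : dotv f =1 dotv g -> f = g.
Proof. by move=> fg; apply/rowP => i; rewrite -!dotv_delta. Qed.

(** * Tensor decompositions as identities of multilinear maps *)

(* The reduction tensor contracted with [x_1, ..., x_k] in [V]. *)
Definition reduction (R : realType) n k (phi : 'rV[R]_n) (x : 'I_k -> 'rV[R]_n) :
  'rV[R]_n :=
  k%:R^-1 *: \sum_(l < k) (\prod_(l' < k | l' != l) dotv phi (x l')) *: x l.

Lemma contract_prod (R : realType) n k (f x : 'I_k -> 'rV[R]_n) :
  \sum_(idx : {ffun 'I_k -> 'I_n})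
     (\prod_(l < k) x l 0 (idx l)) * \prod_(l < k) f l 0 (idx l)
  = \prod_(l < k) dotv (f l) (x l).
Proof.
rewrite bigA_distr_bigA; apply: eq_bigr => idx _ /=.
by rewrite -big_split; apply: eq_bigr => l _; rewrite mulrC.
Qed.

Lemma contract_reduction (R : realType) n k (phi : 'rV[R]_n)
    (x : 'I_k -> 'rV[R]_n) i :
  \sum_(idx : {ffun 'I_k -> 'I_n})
     (\prod_(l < k) x l 0 (idx l)) * reduction_tensor phi idx i
  = reduction phi x 0 i.
Proof.
rewrite /reduction_tensor mxE summxE.
under eq_bigr do rewrite mulrCA.
rewrite -mulr_sumr; congr (_ * _).
under eq_bigr do rewrite mulr_sumr.
rewrite exchange_big /=; apply: eq_bigr => l _; rewrite mxE.
(* Slot [l] carries the [i]th coordinate functional and the others [phi], so the summand is a pure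
   tensor. *)
pose f l' : 'rV[R]_n := if l' == l then delta_mx 0 i else phi.
transitivity (\prod_(l' < k) dotv (f l') (x l')).
  rewrite -contract_prod; apply: eq_bigr => idx _; congr (_ * _).
  rewrite [in RHS](bigD1 l) //= {1}/f eqxx mxE eqxx /=; congr (_ * _).
  by apply: eq_bigr => l' /negPf ne; rewrite /f ne.
rewrite (bigD1 l) //= {1}/f eqxx dotvC dotv_delta mulrC; congr (_ * _).
by apply: eq_bigr => l' /negPf ne; rewrite /f ne.
Qed.

(** Contraction with arbitrary vectors loses nothing, since basis vectors recover the coefficients.
    The convex weights are absorbed into the outputs [y j]. *)
Lemma entanglement_breakingP (R : realType) n k (C : set 'rV[R]_n) (phi : 'rV[R]_n) :
  C 0 -> (forall t x, 0 <= t -> C x -> C (t *: x)) ->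
  entanglement_breaking k C phi <->
  exists (J : finType) (f : J -> 'I_k -> 'rV[R]_n) (y : J -> 'rV[R]_n),
    [/\ forall j l, dual_cone C (f j l), forall j, C (y j)
      & forall x, reduction phi x = \sum_j (\prod_l dotv (f j l) (x l)) *: y j].
Proof.
move=> C0 CZ; split.
  move=> [m [lam [f [y [lam0 _ fP yP Teq]]]]].
  exists 'I_m, f, (fun j => lam j *: y j); split => // [j|x]; first exact: CZ.
  apply/rowP => i; rewrite -contract_reduction summxE.
  under eq_bigr do rewrite Teq mulr_sumr.
  rewrite exchange_big; apply: eq_bigr => j _ /=; rewrite !mxE.
  rewrite -contract_prod mulr_suml; apply: eq_bigr => idx _; ring.
move=> [J [f [y [fP yP Req]]]].
(* The weights have to sum to 1, so a zero term keeps the index set nonempty. *)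
pose N := #|{: option J}|.
have N0 : (0 < N)%N by rewrite /N card_option.
have NR : (N%:R : R) != 0 by rewrite pnatr_eq0 -lt0n.
pose f' (j : option J) l := if j is Some j then f j l else 0.
pose y' (j : option J) := if j is Some j then N%:R *: y j else 0.
exists N, (fun=> N%:R^-1), (fun j => f' (enum_val j)), (fun j => y' (enum_val j)).
split => [_||j l|j|idx i].
- by rewrite invr_ge0.
- by rewrite sumr_const card_ord -(mulr_natr N%:R^-1) mulVf.
- rewrite /f'; case: (enum_val j) => // z _.
  by rewrite dotvC linear0.
- by rewrite /y'; case: (enum_val j) => // z; apply: CZ.
transitivity (\sum_(j : option J) N%:R^-1 *
    ((\prod_(l < k) f' j l 0 (idx l)) * y' j 0 i)); last first.
  by rewrite (reindex _ (onW_bij _ (enum_val_bij (option J)))) /=.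
rewrite (bigD1 None) //= (reindex_omap Some id) /=; last by case.
have -> : reduction_tensor phi idx i = reduction phi (fun l => delta_mx 0 (idx l)) 0 i.
  rewrite -contract_reduction (bigD1 idx) //= big1 ?mul1r => [|l _]; last first.
    by rewrite mxE !eqxx.
  rewrite big1 ?addr0 // => g ne_g.
  have [l] : exists l, g l != idx l.
    apply/existsP; rewrite -negb_forall; apply: contra ne_g => /forallP e.
    by apply/eqP/ffunP => l; apply/eqP.
  by move=> ne; rewrite (bigD1 l) //= mxE (negPf ne) andbF !mul0r.
rewrite Req summxE mxE !mulr0 add0r; apply: eq_big => [j|j _]; rewrite ?eqxx // !mxE.
under eq_bigr do rewrite dotv_delta.
by rewrite [X in _ = X]mulrCA (mulrCA _ N%:R) mulVKf.
Qed.

(** * Strict positivity of interior functionals *)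

Lemma dotv_gt0 (R : realType) n (x : 'rV[R]_n) : x != 0 -> 0 < dotv x x.
Proof.
have sq i : 0 <= x 0 i * x 0 i by rewrite -expr2 sqr_ge0.
move=> x0; rewrite lt_neqAle sumr_ge0 // andbT eq_sym.
apply: contra x0 => /eqP /psumr_eq0P xx0; apply/eqP/rowP => i; rewrite mxE.
by have /eqP := xx0 (fun i _ => sq i) i isT; rewrite mulf_eq0 orbb => /eqP.
Qed.

(** For small [t > 0] the functional [phi - t *: x] is still in the dual cone; evaluate it at
    [x]. *)
Lemma dual_interior_gt0 (R : realType) n (C : set 'rV[R]_n) phi x :
  interior (dual_cone C) phi -> C x -> x != 0 -> 0 < dotv phi x.
Proof.
move=> /nbhs_ballP [e /= e0 sub] Cx x0.
pose t := e / 2 / (`|x| + 1).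
have nx : 0 < `|x| + 1 by rewrite ltr_wpDl.
have t0 : 0 < t by rewrite !divr_gt0.
have : dual_cone C (phi - t *: x).
  apply: sub; rewrite -ball_normE /ball_ /= opprB addrCA subrr addr0 normrZ gtr0_norm //.
  rewrite /t -mulrA [_^-1 * _]mulrC.
  have : `|x| / (`|x| + 1) < 1 by rewrite ltr_pdivrMr // mul1r ltrDl.
  have : 0 <= `|x| / (`|x| + 1) by rewrite divr_ge0 // ltW.
  nra.
move=> /(_ x Cx); rewrite dotvC linearB linearZ /= subr_ge0 (dotvC x phi).
by apply: lt_le_trans; rewrite mulr_gt0 // dotv_gt0.
Qed.

(** * Bases inside a spanning cone and extension of additive functions *)

Section ConeExtension.
Variables (R : realType) (n : nat) (C : set 'rV[R]_n).
Hypothesis C_spans : forall f : 'rV[R]_n, f != 0 -> exists x, C x /\ dotv f x != 0.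

Lemma dotvE (f x : 'rV[R]_n) : (x *m f^T) 0 0 = dotv f x.
Proof. by rewrite mxE; apply: eq_bigr => i _; rewrite mxE mulrC. Qed.

(** As long as [r < n], some nonzero [f] kills the rows found so far, and a cone element on which
    [f] is nonzero is independent of them. *)
Lemma cone_free_family r : (r <= n)%N ->
  exists M : 'M[R]_(r, n), row_free M /\ forall i, C (row i M).
Proof.
elim: r => [_|r IH lt_rn]; first by exists 0; split=> [|[] //]; rewrite /row_free mxrank0.
have [M [free_M CM]] := IH (ltnW lt_rn).
have : kermx M^T != 0.
  rewrite -mxrank_eq0 mxrank_ker mxrank_tr (eqP free_M).
  by rewrite -lt0n subn_gt0.
move=> /rowV0Pn [f fK f0].
have fM : M *m f^T = 0.
  by apply: trmx_inj; rewrite trmx_mul trmxK trmx0; apply/sub_kermxP.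
have [x [Cx fx]] := C_spans f0.
exists (col_mx x M); split; last first.
  move=> i; case: (@splitP 1 r i) => j ij.
    have -> : row i (col_mx x M) = x; last by [].
    apply/rowP => h; rewrite mxE (_ : i = lshift r j); last exact: val_inj.
    by rewrite [LHS](col_mxEu x M j h) (ord1 j).
  have -> : row i (col_mx x M) = row j M; last by [].
  apply/rowP => h; rewrite mxE (_ : i = rshift 1 j); last exact: val_inj.
  by rewrite [LHS](col_mxEd x M j h) mxE.
suff : @row_free R (1 + r) n (col_mx x M) by [].
apply: inj_row_free => v; rewrite -[v]hsubmxK mul_row_col => vM.
have l0 : lsubmx v = 0.
  have := congr1 (fun w => (w *m f^T) 0 0) vM.
  rewrite mulmxDl -!mulmxA fM mulmx0 addr0 mul0mx [lsubmx v]mx11_scalar.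
  rewrite /= mul_scalar_mx mxE dotvE [RHS]mxE => /eqP.
  by rewrite mulf_eq0 (negPf fx) orbF => /eqP ->; rewrite raddf0.
move: vM; rewrite l0 mul0mx add0r => /eqP.
by rewrite mulmx_free_eq0 // => /eqP ->; rewrite row_mx0.
Qed.

Lemma eq_on_cone (f g : 'rV[R]_n) : (forall x, C x -> dotv f x = dotv g x) -> f = g.
Proof.
move=> fg; apply/eqP; rewrite -subr_eq0; apply/negP => /negP /C_spans [x [Cx]].
by rewrite dotvC linearB /= dotvC fg // dotvC subrr eqxx.
Qed.

Hypothesis C0 : C 0.
Hypothesis CD : forall x y, C x -> C y -> C (x + y).
Hypothesis CZ : forall (t : R) x, 0 <= t -> C x -> C (t *: x).

Lemma cone_sum (I : finType) (P : pred I) (c : I -> R) (x : I -> 'rV[R]_n) :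
  (forall i, P i -> 0 <= c i) -> (forall i, P i -> C (x i)) ->
  C (\sum_(i | P i) c i *: x i).
Proof. by move=> c0 xC; apply: big_ind => // i Pi; apply: CZ; auto. Qed.

(** Split the coordinates in a basis taken from [C] into positive and negative parts. *)
Lemma cone_difference x : exists p q, [/\ C p, C q & x = p - q].
Proof.
have [B [free_B CB]] := cone_free_family (leqnn n).
have unit_B : B \in unitmx by rewrite -row_free_unit.
pose c := x *m invmx B.
exists (\sum_i Num.max (c 0 i) 0 *: row i B), (\sum_i Num.max (- c 0 i) 0 *: row i B).
split; try by apply: cone_sum => // i _; rewrite le_max lexx orbT.
rewrite -[LHS](mulmxKV unit_B) -/c mulmx_sum_row -sumrB; apply: eq_bigr => i _.
rewrite -scalerBl; congr (_ *: _).
by case: (leP (c 0 i) 0) => c0; case: (leP (- c 0 i) 0) => c1; lra.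
Qed.

Variable H : 'rV[R]_n -> R.
Hypothesis HD : forall x y, C x -> C y -> H (x + y) = H x + H y.
Hypothesis HZ : forall t x, 0 <= t -> C x -> H (t *: x) = t * H x.

(** The functional is prescribed on a basis taken from [C]. For [x] in [C], the positive part [p]
    and negative part [q] satisfy [x + q = p] inside the cone, where [H] is additive. *)
Lemma cone_linear_extension : exists f, forall x, C x -> dotv f x = H x.
Proof.
have H0 : H 0 = 0 by rewrite -(scale0r 0) HZ // mul0r.
have [B [free_B CB]] := cone_free_family (leqnn n).
have unit_B : B \in unitmx by rewrite -row_free_unit.
have Hsum (c : 'I_n -> R) : (forall i, 0 <= c i) ->
    C (\sum_i c i *: row i B) /\ H (\sum_i c i *: row i B) = \sum_i c i * H (row i B).
  move=> c0; apply: (big_rec2 (fun u h => C u /\ H u = h)) => // i h u _ [Cu <-].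
  have Ci : C (c i *: row i B) by apply: CZ.
  by split; [apply: CD | rewrite HD // HZ].
exists ((invmx B *m \col_i H (row i B))^T) => x Cx.
rewrite -dotvE trmxK mulmxA mxE; set c := x *m invmx B.
have xE : x = \sum_i c 0 i *: row i B by rewrite -mulmx_sum_row mulmxKV.
have pos i : 0 <= Num.max (c 0 i) 0 by rewrite le_max lexx orbT.
have neg i : 0 <= Num.max (- c 0 i) 0 by rewrite le_max lexx orbT.
have cE i : Num.max (c 0 i) 0 = c 0 i + Num.max (- c 0 i) 0.
  by case: (leP (c 0 i) 0) => c0; case: (leP (- c 0 i) 0) => c1; lra.
have [Cp Hp] := Hsum _ pos; have [Cq Hq] := Hsum _ neg.
have := HD Cx Cq; rewrite Hq {1}xE -big_split /=.
under eq_bigr do rewrite -scalerDl -cE.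
rewrite Hp => /eqP; rewrite -subr_eq -sumrB => /eqP <-.
by apply: eq_bigr => i _; rewrite mxE cE; ring.
Qed.

End ConeExtension.

(** * From a product of simplices to a decomposition *)

(** [cls t] is the factor of the vertex [t], and [q t] its homogenised barycentric coordinate. A
    term is given by a shift [s] and a choice [h] of one vertex per factor; slot [l] is measured by
    [q (h (l - s))]. *)
Lemma simplex_coordinates_entanglement_breaking (R : realType) n k
    (C : set 'rV[R]_n) (phi : 'rV[R]_n) (T : finType) (cls : T -> 'I_k.+1)
    (q : T -> 'rV[R]_n) :
  C 0 -> (forall t x, 0 <= t -> C x -> C (t *: x)) ->
  (forall t, dual_cone C (q t)) ->
  (forall i x, \sum_(t | cls t == i) dotv (q t) x = dotv phi x) ->
  (forall x, (forall t, dotv (q t) x = 0) -> x = 0) ->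
  (forall h : 'I_k.+1 -> T, (forall i, cls (h i) = i) ->
     exists y, C y /\ forall t, dotv (q t) y = (h (cls t) == t)%:R) ->
  entanglement_breaking k.+1 C phi.
Proof.
move=> C0 CZ qC qphi q_inj vertex.
pose Q i t := cls t == i.
have /choice [y yP] (h : {ffun 'I_k.+1 -> T}) : exists y, C y /\
    (h \in family Q -> forall t, dotv (q t) y = (h (cls t) == t)%:R).
  case: (boolP (h \in family Q)) => [/familyP hQ|_]; last by exists 0.
  by have [i|y [Cy yq]] := vertex h; [apply/eqP; apply: hQ | exists y].
apply/entanglement_breakingP => //.
pose J : finType := ('I_k.+1 * {ffun 'I_k.+1 -> T})%type.
exists J, (fun (sh : J) l => q (sh.2 (l - sh.1))).
exists (fun sh : J => if sh.2 \in family Q then k.+1%:R^-1 *: y sh.2 else 0).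
split=> // [[s h] /=|x].
  by case: ifP => // _; apply: CZ; [rewrite invr_ge0 | case: (yP h)].
apply/eqP; rewrite -subr_eq0; apply/eqP/q_inj => t.
rewrite linearB /=; apply/eqP; rewrite subr_eq0; apply/eqP.
rewrite /reduction linearZ linear_sum /= linear_sum /= mulr_sumr.
rewrite -(pair_bigA _ (fun (s : 'I_k.+1) (h : {ffun 'I_k.+1 -> T}) =>
  dotv (q t) (\prod_l dotv (q (h (l - s))) (x l) *:
   (if h \in family Q then k.+1%:R^-1 *: y h else 0)))) /=.
(* Under the shift [s], factor [cls t] receives the point in slot [cls t + s]. *)
rewrite (reindex_inj (addrI (cls t))) /=; apply: eq_bigr => s _.
rewrite linearZ /=.
under [RHS]eq_bigr => h _ do rewrite (reindex_inj (addIr s)) linearZ /=.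
under [RHS]eq_bigr => h _ do under eq_bigr => i _ do rewrite addrK.
(* The condition [h (cls t) = t] moves into one factor of the product, so the sum over [h]
   factorises: factor [cls t] yields [q t], and every other one sums to [phi]. *)
pose F i t' := dotv (q t') (x (i + s)) * (if i == cls t then (t' == t)%:R else 1).
transitivity (k.+1%:R^-1 * \sum_(h in family Q) \prod_i F i (h i)); last first.
  rewrite mulr_sumr big_mkcond /=; apply: eq_bigr => h _.
  case: ifP => hQ; last by rewrite linear0 mulr0.
  rewrite linearZ /= (yP h).2 // mulrCA; congr (_ * _).
  rewrite /F big_split /=; congr (_ * _).
  by rewrite (bigD1 (cls t)) //= eqxx big1 ?mulr1 // => i /negPf ->.
rewrite -bigA_distr_big_dep; congr (_ * _).
rewrite [in RHS](bigD1 (cls t)) //= mulrC; congr (_ * _).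
  rewrite (bigD1 t) /Q //= /F !eqxx mulr1 big1 ?addr0 // => t' /andP [_ /negPf ->].
  by rewrite mulr0.
rewrite (reindex_inj (addIr s)) /=; apply: eq_big => [i|i].
  by rewrite (inj_eq (addIr s)).
rewrite (inj_eq (addIr s)) => /negPf ne; rewrite -(qphi i); apply: eq_bigr => t' _.
by rewrite /F ne mulr1.
Qed.

Section FromSimplices.
Variables (R : realType) (n : nat) (C : set 'rV[R]_n) (phi : 'rV[R]_n).
Hypothesis C_spans : forall f : 'rV[R]_n, f != 0 -> exists x, C x /\ dotv f x != 0.
Hypothesis C0 : C 0.
Hypothesis CD : forall x y, C x -> C y -> C (x + y).
Hypothesis CZ : forall (t : R) x, 0 <= t -> C x -> C (t *: x).
Hypothesis phi_gt0 : forall x, C x -> x != 0 -> 0 < dotv phi x.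

Lemma phi_ge0 x : C x -> 0 <= dotv phi x.
Proof. by have [->|x0 Cx] := eqVneq x 0; [rewrite linear0 | rewrite ltW // phi_gt0]. Qed.

Lemma phi_eq0 x : C x -> dotv phi x = 0 -> x = 0.
Proof.
move=> Cx px; apply: contraTeq isT => x0.
by have := phi_gt0 Cx x0; rewrite px ltxx.
Qed.

Lemma base_normalize x : C x -> x != 0 -> base_K C phi ((dotv phi x)^-1 *: x).
Proof.
move=> Cx x0; have p := phi_gt0 Cx x0; split; first by apply: CZ => //; rewrite invr_ge0 ltW.
by rewrite linearZ /= mulVf // gt_eqF.
Qed.

(** The homogenisation [H] of [h] is additive: the normalised sum of two nonzero cone points is a
    convex combination of the normalised points, with weights proportional to their [phi]-values. *)
Lemma affine_extension (h : 'rV[R]_n -> R) :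
  (forall x y (t : R), base_K C phi x -> base_K C phi y -> 0 <= t -> t <= 1 ->
     h (t *: x + (1 - t) *: y) = t * h x + (1 - t) * h y) ->
  exists f, forall x, base_K C phi x -> dotv f x = h x.
Proof.
move=> haff; pose H x := dotv phi x * h ((dotv phi x)^-1 *: x).
have HD x y : C x -> C y -> H (x + y) = H x + H y.
  have [-> _ _|x0 Cx] := eqVneq x 0; first by rewrite /H !linear0 mul0r !add0r.
  have [-> _|y0 Cy] := eqVneq y 0; first by rewrite /H !linear0 mul0r !addr0.
  have px := phi_gt0 Cx x0; have py := phi_gt0 Cy y0.
  have pxy : 0 < dotv phi x + dotv phi y by rewrite addr_gt0.
  rewrite /H linearD /=; set a := dotv phi x in px pxy *; set b := dotv phi y in py pxy *.
  have t1 : 1 - a / (a + b) = b / (a + b) by field; rewrite gt_eqF.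
  have := haff _ _ (a / (a + b)) (base_normalize Cx x0) (base_normalize Cy y0).
  rewrite -/a -/b t1 !scalerA.
  have -> : a / (a + b) * a^-1 = (a + b)^-1 by field; rewrite !gt_eqF.
  have -> : b / (a + b) * b^-1 = (a + b)^-1 by field; rewrite !gt_eqF.
  rewrite -scalerDr => ->; first by field; rewrite gt_eqF.
    by rewrite divr_ge0 // ltW.
  by rewrite ler_pdivrMr // mul1r lerDl ltW.
have HZ t x : 0 <= t -> C x -> H (t *: x) = t * H x.
  rewrite le0r => /orP [/eqP -> _|t0 _]; first by rewrite /H scale0r linear0 !mul0r.
  rewrite /H linearZ /= scalerA -mulrA; congr (t * (_ * h (_ *: _))).
  by rewrite invfM mulrAC mulVf ?mul1r // gt_eqF.
have [f fH] := cone_linear_extension C_spans C0 CD CZ HD HZ.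
by exists f => x [Cx px]; rewrite fH // /H px mul1r invr1 scale1r.
Qed.

Lemma eq_on_base (f g : 'rV[R]_n) :
  (forall x, base_K C phi x -> dotv f x = dotv g x) -> f = g.
Proof.
move=> fg; apply: (eq_on_cone C_spans) => x Cx.
have [->|x0] := eqVneq x 0; first by rewrite !linear0.
have := fg _ (base_normalize Cx x0); rewrite !linearZ /= => /mulfI -> //.
by rewrite invr_eq0 gt_eqF // phi_gt0.
Qed.

Lemma simplex_prod_entanglement_breaking k m (d : 'I_m -> nat) :
  (m <= k.+1)%N -> affinely_isomorphic (base_K C phi) (@simplex_prod R m d) ->
  entanglement_breaking k.+1 C phi.
Proof.
move=> le_mk [F [F_to F_inj F_onto F_aff]].
pose T0 := {i : 'I_m & 'I_(d i).+1}.
have /choice [p pP] (t : T0) :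
    exists p : 'rV[R]_n, forall x, base_K C phi x -> dotv p x = F x t.
  by apply: affine_extension => x y s Kx Ky s0 s1; rewrite F_aff // !ffunE.
have p_dual t : dual_cone C (p t).
  move=> x Cx; have [->|x0] := eqVneq x 0; first by rewrite linear0.
  have Kx := base_normalize Cx x0.
  have := (F_to _ Kx).1 t; rewrite -pP // linearZ /= pmulr_rge0 // invr_gt0.
  exact: phi_gt0.
have p_phi i x : \sum_(j < (d i).+1) dotv (p (Tagged (fun i => 'I_(d i).+1) j)) x
    = dotv phi x.
  rewrite dotvC; under eq_bigr do rewrite dotvC.
  rewrite -linear_sum /=; congr (dotv x _); apply: eq_on_base => {}x Kx.
  rewrite dotvC linear_sum /= Kx.2 -[RHS]((F_to _ Kx).2 i).
  by apply: eq_bigr => j _; rewrite dotvC pP.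
(* For [m = 0] no coordinates exist to imply [dotv phi x = 0]; after padding, factor [ord0] always
   supplies it. *)
have p_inj x : dotv phi x = 0 -> (forall t, dotv (p t) x = 0) -> x = 0.
  have [y [z [Cy Cz ->]]] := cone_difference C_spans C0 CD CZ x.
  rewrite linearB /= => /eqP; rewrite subr_eq0 => /eqP yz px.
  have [z0|z0] := eqVneq z 0.
    by move: yz; rewrite z0 linear0 subr0 => /phi_eq0 ->.
  have [y0|y0] := eqVneq y 0.
    by move: yz; rewrite y0 linear0 => /esym /phi_eq0 ->; rewrite ?subr0.
  have pz := phi_gt0 Cz z0.
  apply/eqP; rewrite subr_eq0; apply/eqP.
  suff /(scalerI (a := (dotv phi z)^-1)) : (dotv phi z)^-1 *: y = (dotv phi z)^-1 *: z.
    by apply; rewrite invr_eq0 gt_eqF.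
  have Ky := base_normalize Cy y0; have Kz := base_normalize Cz z0.
  rewrite yz in Ky; apply: F_inj => //; apply/ffunP => t; rewrite -!pP // !linearZ /=.
  by congr (_ * _); apply/eqP; rewrite -subr_eq0 -linearB; apply/eqP/px.
(* The product is padded to exactly [k.+1] factors by points. *)
pose T := (T0 + {i : 'I_k.+1 | (m <= i)%N})%type.
pose cls (t : T) := match t with
  inl t => widen_ord le_mk (tag t) | inr i => val i end.
pose q (t : T) := if t is inl t then p t else phi.
have q_phi i x : \sum_(t | cls t == i) dotv (q t) x = dotv phi x.
  rewrite big_sumType /=.
  have [lt_im|le_mi] := ltnP i m.
    rewrite [X in _ + X]big1 ?addr0 => [|[j le_mj] /= /eqP ji]; last first.
      by move: le_mj; rewrite ji leqNgt lt_im.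
    rewrite -(p_phi (Ordinal lt_im)).
    transitivity (\sum_(i' < m | widen_ord le_mk i' == i)
      \sum_(j < (d i').+1) dotv (p (Tagged (fun i => 'I_(d i).+1) j)) x).
      by rewrite [RHS]sig_big_dep; apply: eq_big => [t|[]//]; rewrite andbT.
    by rewrite (big_pred1 (Ordinal lt_im)).
  rewrite big1 ?add0r => [|t /= /eqP ti]; last first.
    by move: le_mi; rewrite -ti leqNgt /= ltn_ord.
  rewrite (bigD1 (exist _ i le_mi)) //= big1 ?addr0 // => j /andP [/= /eqP ji].
  by rewrite -val_eqE /= ji eqxx.
apply: (@simplex_coordinates_entanglement_breaking _ _ _ _ _ T cls q) => //.
- by case=> [t|i] x; [apply: p_dual | apply: phi_ge0].
- move=> x qx; apply: p_inj => [|t]; last exact: (qx (inl t)).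
  by rewrite -(q_phi ord0 x) big1.
move=> h clsh.
pose P := [ffun t : T0 => (h (widen_ord le_mk (tag t)) == inl t)%:R : R].
have /F_onto [y [Ky Fy]] : simplex_prod P.
  split=> [t|i]; first by rewrite ffunE ler0n.
  under eq_bigr do rewrite ffunE /=.
  have := clsh (widen_ord le_mk i); case: (h _) => [[i0 j0]|[i0 le_mi0]] /=.
    move=> /(congr1 val) /= /val_inj ii0; subst i0.
    rewrite (bigD1 j0) //= eqxx big1 ?addr0 // => j ne.
    by case: eqP => // -[] /eqP; rewrite eq_Tagged /= eq_sym (negPf ne).
  by move=> i0E; move: le_mi0; rewrite i0E /= leqNgt ltn_ord.
exists y; split=> [|[t|i]]; first exact: Ky.1.
  by rewrite /q pP // Fy ffunE.
rewrite /q Ky.2 /=; have := clsh (val i); case: (h _) => [t|i'] /=.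
  by move=> /(congr1 val) /= tE; have := valP i; rewrite /= -tE leqNgt ltn_ord.
by move=> /val_inj ->; rewrite eqxx.
Qed.
End FromSimplices.

(** * Coordinates that realise a product of simplices *)

(** Enumerating each class of [cls] identifies [T] with the index type of the product; classes are
    nonempty, so class [i] has [(d i).+1] members. *)
Lemma simplex_coordinates_iso (R : realType) n (K : set 'rV[R]_n) (T : finType) m
    (cls : T -> 'I_m) (q : T -> 'rV[R]_n) :
  (forall i, exists t, cls t = i) ->
  (forall x t, K x -> 0 <= dotv (q t) x) ->
  (forall x i, K x -> \sum_(t | cls t == i) dotv (q t) x = 1) ->
  (forall x y, K x -> K y -> (forall t, dotv (q t) x = dotv (q t) y) -> x = y) ->
  (forall p : T -> R, (forall t, 0 <= p t) ->
     (forall i, \sum_(t | cls t == i) p t = 1) ->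
     exists x, K x /\ forall t, dotv (q t) x = p t) ->
  exists d : 'I_m -> nat, affinely_isomorphic K (@simplex_prod R m d).
Proof.
move=> /choice [t0 clst0] q_ge0 q_sum q_inj q_onto.
pose cl (i : 'I_m) := enum [pred t | cls t == i].
pose d (i : 'I_m) := (size (cl i)).-1; pose e i j := nth (t0 i) (cl i) j.
have sz i : size (cl i) = (d i).+1.
  rewrite prednK // /cl -cardE; apply/card_gt0P; exists (t0 i).
  by rewrite inE clst0.
have sumE i (G : T -> R) : \sum_(t | cls t == i) G t = \sum_(j < (d i).+1) G (e i j).
  by rewrite -big_enum /= (big_nth (t0 i)) sz big_mkord.
have cls_e i (j : 'I_(d i).+1) : cls (e i j) = i.
  have : e i j \in cl i by rewrite mem_nth // sz.
  by rewrite mem_enum inE => /eqP.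
exists d, (fun x => [ffun u : {i : 'I_m & 'I_(d i).+1} =>
  dotv (q (e (tag u) (tagged u))) x]); split.
- move=> x Kx; split=> [t|i]; first by rewrite ffunE q_ge0.
  by rewrite -(q_sum x i Kx) sumE; apply: eq_bigr => j _; rewrite ffunE.
- move=> x y Kx Ky /ffunP xy; apply: q_inj => // t.
  have tcl : t \in cl (cls t) by rewrite mem_enum inE.
  have lt_t : (index t (cl (cls t)) < (d (cls t)).+1)%N by rewrite -sz index_mem.
  have := xy (Tagged (fun i => 'I_(d i).+1) (Ordinal lt_t)).
  by rewrite !ffunE /= /e nth_index.
- move=> p [p_ge0 p_sum].
  pose P (t : T) : R := p (existT (fun i => 'I_(d i).+1) (cls t) (inord (index t (cl (cls t))))).
  have PE i (j : 'I_(d i).+1) : P (e i j) = p (Tagged (fun i => 'I_(d i).+1) j).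
    have : index (e i j) (cl i) = j by rewrite index_uniq ?enum_uniq // sz.
    rewrite /P; move: (e i j) (cls_e i j) => t ct.
    (* Substituting [cls t = i] puts both ordinals in the same type. *)
    by case: _ / ct j => j ->; rewrite inord_val.
  have [] := q_onto P; first by move=> t; apply: p_ge0.
    by move=> i; rewrite sumE -(p_sum i); apply: eq_bigr => j _; rewrite PE.
  by move=> x [Kx qx]; exists x; split=> //; apply/ffunP => -[i j]; rewrite ffunE qx PE.
- by move=> x y t _ _ _ _; apply/ffunP => u; rewrite !ffunE linearD !linearZ.
Qed.

(** * Special values of the reduction map *)

Lemma reduction_diag (R : realType) n k (phi x : 'rV[R]_n) :
  reduction phi (fun _ : 'I_k.+1 => x) = dotv phi x ^+ k *: x.
Proof.
rewrite /reduction (eq_bigr (fun=> dotv phi x ^+ k *: x)) => [|l _].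
  rewrite sumr_const card_ord -(scaler_nat k.+1 (_ *: x)) !scalerA mulrA mulVf ?mul1r //.
by rewrite prodr_const cardC1 card_ord.
Qed.

Lemma reduction_slot0 (R : realType) n k (phi r v : 'rV[R]_n) :
  dotv phi v = 1 ->
  reduction phi (fun l : 'I_k.+1 => if l == ord0 then r else v)
  = k.+1%:R^-1 *: (r + (k%:R * dotv phi r) *: v).
Proof.
move=> phiv; congr (_ *: _); rewrite (bigD1 ord0) //=; congr (_ + _).
  by rewrite big1 ?scale1r // => l /negPf ->.
rewrite (eq_bigr (fun=> dotv phi r *: v)) => [|l l0].
  by rewrite sumr_const cardC1 card_ord -(scaler_nat k (_ *: v)) scalerA.
rewrite (negPf l0) (bigD1 ord0) 1?eq_sym //= big1 ?mulr1 // => l' /andP [_ /negPf ->].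
by [].
Qed.

(** * Irredundant facets *)

Lemma large_multiple_ge0 (R : realType) (T : finType) (P : pred T) (p u : T -> R) :
  (forall a, P a -> 0 < p a) -> exists s, forall a, P a -> 0 <= s * p a + u a.
Proof.
move=> p0; exists (\sum_(a | P a) `|u a| / p a) => a Pa.
rewrite (bigD1 a) //= mulrDl divfK ?gt_eqF ?p0 // -addrA addrCA.
rewrite addr_ge0 //; last first.
  by rewrite -lerBlDr sub0r -normrN ler_norm.
apply: mulr_ge0; last exact/ltW/p0.
by apply: sumr_ge0 => b /andP [Pb _]; rewrite divr_ge0 // ltW // p0.
Qed.

(* [z a] satisfies all constraints, with equality only in the [a]th. *)
Definition cone_facets (R : realType) n (C : set 'rV[R]_n) (T : finType)
    (F z : T -> 'rV[R]_n) :=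
  [/\ forall a, dual_cone C (F a),
      forall x, (forall a, 0 <= dotv (F a) x) -> C x,
      forall a, dotv (F a) (z a) = 0
    & forall a b, a != b -> 0 < dotv (F b) (z a)].

(** In a minimal subfamily cutting out [C], dropping [a] admits a point [x] that violates only the
    constraint [a]. Moving [x] in the direction [e] until this constraint becomes an equality gives
    [z a]. *)
Lemma facets_exist (R : realType) n (C : set 'rV[R]_n) (I : finType)
    (f : I -> 'rV[R]_n) (e : 'rV[R]_n) :
  (forall i, dual_cone C (f i)) -> (forall i, 0 < dotv (f i) e) ->
  (forall x, (forall i, 0 <= dotv (f i) x) -> C x) ->
  exists (T : finType) (F z : T -> 'rV[R]_n),
    cone_facets C F z /\ forall a, 0 < dotv (F a) e.
Proof.
move=> f_dual fe fC.
pose cuts (A : {set I}) := `[< forall x, (forall i, i \in A -> 0 <= dotv (f i) x) -> C x >].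
have [|A /minsetP [/asboolP cutsA minA]] := @ex_minset _ cuts.
  by exists [set: I]%SET; apply/asboolP => x Hx; apply: fC => i; apply: Hx; rewrite inE.
have /choice [z zP] (a : {i | i \in A}) : exists z, dotv (f (val a)) z = 0 /\
    forall b : {i | i \in A}, a != b -> 0 < dotv (f (val b)) z.
  have /existsNP [x /not_implyP [fx nCx]] : ~ (forall x,
      (forall i, i \in (A :\ val a)%SET -> 0 <= dotv (f i) x) -> C x).
    move=> /asboolP /minA /(_ (subsetDl _ _)) AE.
    move: (valP a) AE => /=; move: (sval a) => a' a'A AE.
    by move: a'A; rewrite -AE !inE eqxx.
  have fax : dotv (f (val a)) x < 0.
    rewrite ltNge; apply/negP => fax; apply: nCx; apply: cutsA => i iA.
    by have [->//|ia] := eqVneq i (val a); apply: fx; rewrite !inE ia.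
  pose s := - dotv (f (val a)) x / dotv (f (val a)) e.
  have s0 : 0 < s by rewrite divr_gt0 // oppr_gt0.
  exists (x + s *: e); split=> [|b ab]; rewrite linearD linearZ /=.
    by rewrite divfK ?gt_eqF // subrr.
  apply: ltr_wpDl; last by rewrite mulr_gt0.
  by apply: fx; rewrite !inE (valP b) andbT; apply: contra ab => /eqP/val_inj ->.
exists {i | i \in A}, (fun a => f (val a)), z; split=> //; split=> //.
- by move=> x Hx; apply: cutsA => i iA; apply: (Hx (exist _ i iA)).
- by move=> a; case: (zP a).
- by move=> a b; case: (zP a) => _; apply.
Qed.

(** Any [d] with [F a] zero enters [C] after adding a large multiple of [z a], where [g] vanishes.
    So [g] is nonnegative on the hyperplane of [F a], hence zero there. *)
Lemma facet_unique (R : realType) n (C : set 'rV[R]_n) (T : finType)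
    (F z : T -> 'rV[R]_n) a e g :
  cone_facets C F z -> 0 < dotv (F a) e ->
  dual_cone C g -> dotv g (z a) = 0 -> exists c, g = c *: F a.
Proof.
move=> [F_dual FC za zab] Fe g_dual gz.
have g_ge0 d : dotv (F a) d = 0 -> 0 <= dotv g d.
  move=> Fd.
  have [|s sP] := @large_multiple_ge0 R T (fun b => a != b) (fun b => dotv (F b) (z a))
    (fun b => dotv (F b) d); first by move=> b; apply: zab.
  have : C (s *: z a + d).
    apply: FC => b; rewrite linearD linearZ /=.
    by have [<-|/sP //] := eqVneq a b; rewrite za Fd mulr0 addr0.
  by move=> /g_dual; rewrite linearD linearZ /= gz mulr0 add0r.
exists (dotv g e / dotv (F a) e); apply: dotv_eq => x.
rewrite [RHS]dotvC linearZ /= [dotv x _]dotvC.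
pose d := x - (dotv (F a) x / dotv (F a) e) *: e.
have Fd : dotv (F a) d = 0 by rewrite linearB linearZ /= divfK ?gt_eqF // subrr.
have : dotv g d = 0.
  apply/eqP; rewrite eq_le g_ge0 // andbT -oppr_ge0 -linearN g_ge0 //.
  by rewrite raddfN /= Fd oppr0.
rewrite linearB linearZ /= => /eqP; rewrite subr_eq0 => /eqP ->.
by ring.
Qed.

(** * From a decomposition to facets and slots *)

Section ToSimplices.
Variables (R : realType) (n k : nat) (C : set 'rV[R]_n) (phi : 'rV[R]_n).
Hypothesis C_spans : forall f : 'rV[R]_n, f != 0 -> exists x, C x /\ dotv f x != 0.
Hypothesis C0 : C 0.
Hypothesis CD : forall x y, C x -> C y -> C (x + y).
Hypothesis CZ : forall (t : R) x, 0 <= t -> C x -> C (t *: x).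
Hypothesis phi_gt0 : forall x, C x -> x != 0 -> 0 < dotv phi x.
Variables (J : finType) (f : J -> 'I_k.+1 -> 'rV[R]_n) (y : J -> 'rV[R]_n).
Hypothesis f_dual : forall j l, dual_cone C (f j l).
Hypothesis yC : forall j, C (y j).
Hypothesis reductionE :
  forall x, reduction phi x = \sum_j (\prod_l dotv (f j l) (x l)) *: y j.

Lemma strictly_positive_point : (0 < n)%N ->
  exists e, [/\ C e, dotv phi e = 1 & forall j l, f j l != 0 -> 0 < dotv (f j l) e].
Proof.
move=> n0.
have [x1 [Cx1 x10]] : exists x, C x /\ x != 0.
  have d0 : (delta_mx 0 (Ordinal n0) : 'rV[R]_n) != 0.
    apply/eqP => /rowP /(_ (Ordinal n0)) /eqP.
    by rewrite !mxE !eqxx oner_eq0.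
  have [x [Cx dx]] := C_spans d0; exists x; split=> //.
  by apply: contraNneq dx => ->; rewrite linear0.
have /choice [x xP] (i : J * 'I_k.+1) : exists x, C x /\
    (f i.1 i.2 != 0 -> 0 < dotv (f i.1 i.2) x).
  have [->|fi] := eqVneq (f i.1 i.2) 0; first by exists 0.
  have [x [Cx fx]] := C_spans fi; exists x; split=> // _.
  by rewrite lt_neqAle eq_sym fx f_dual.
(* The nonzero [x1] allows normalisation by [phi] even if every [f j l] is zero. *)
pose e := x1 + \sum_i x i.
have Cs (P : pred (J * 'I_k.+1)) : C (\sum_(i | P i) x i).
  by apply: big_ind => // i _; case: (xP i).
have fe j l : f j l != 0 -> 0 < dotv (f j l) e.
  move=> fjl; rewrite linearD ltr_wpDl //= ?f_dual //.
  rewrite (bigD1 (j, l)) //= linearD ltr_pwDl //= ?f_dual //.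
  by case: (xP (j, l)) => _; apply.
have pe : 0 < dotv phi e.
  by rewrite linearD ltr_pwDl //= ?phi_gt0 // (phi_ge0 phi_gt0).
have Ce : C e by apply: CD.
exists ((dotv phi e)^-1 *: e); split.
- by apply: CZ => //; rewrite invr_ge0 ltW.
- by rewrite linearZ /= mulVf // gt_eqF.
- by move=> j l fjl; rewrite linearZ /= mulr_gt0 ?invr_gt0 ?fe.
Qed.

Lemma reduction_cone x : (forall j l, 0 <= dotv (f j l) (x l)) -> C (reduction phi x).
Proof.
move=> fx; rewrite reductionE.
by apply: cone_sum => // j _; apply: prodr_ge0.
Qed.

(** With [x] in one slot and [e] in the others, [x + k phi(x) e] lies in [C], so [phi(x) >= 0]. If
    [phi(x) = 0], this point is [x]; otherwise the diagonal value [phi(x)^k x] lies in [C] and can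
    be rescaled. *)
Lemma cone_of_factors e x : C e -> dotv phi e = 1 ->
  (forall j l, 0 <= dotv (f j l) x) -> C x.
Proof.
move=> Ce phie fx.
have /(CZ (ler0n _ k.+1)) : C (reduction phi (fun l : 'I_k.+1 => if l == ord0 then x else e)).
  by apply: reduction_cone => j l; case: ifP => _; [apply: fx | apply: f_dual].
rewrite reduction_slot0 // scalerA mulfV ?pnatr_eq0 // scale1r => Cxe.
have := phi_ge0 phi_gt0 Cxe.
rewrite linearD linearZ /= phie mulr1 -{1}[dotv phi x]mul1r -mulrDl.
rewrite pmulr_rge0 ?ltr_pwDl // le0r => /orP [/eqP px|px].
  by move: Cxe; rewrite px mulr0 scale0r addr0.
have : C (reduction phi (fun _ : 'I_k.+1 => x)) by apply: reduction_cone.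
rewrite reduction_diag => /(CZ (_ : 0 <= (dotv phi x ^+ k)^-1)).
rewrite scalerA mulVf ?scale1r; first by apply; rewrite invr_ge0 exprn_ge0 // ltW.
by rewrite expf_neq0 // gt_eqF.
Qed.

Lemma term_exists F x : dotv F (reduction phi x) != 0 ->
  exists j, (\prod_l dotv (f j l) (x l) != 0) /\ dotv F (y j) != 0.
Proof.
rewrite reductionE linear_sum /= => nz; apply: contrapT => no; case/eqP: nz.
apply: big1 => j _; rewrite linearZ /=; apply/eqP; rewrite mulf_eq0.
by apply: contrapT => /negP; rewrite negb_or => /andP nz; apply: no; exists j.
Qed.

Variables (T : finType) (F z : T -> 'rV[R]_n) (e : 'rV[R]_n).
Hypothesis facets : cone_facets C F z.
Hypothesis Ce : C e.
Hypothesis phie : dotv phi e = 1.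
Hypothesis Fe : forall a, 0 < dotv (F a) e.

Let F_dual : forall a, dual_cone C (F a). Proof. by case: facets. Qed.
Let F_cone : forall x, (forall a, 0 <= dotv (F a) x) -> C x.
Proof. by case: facets. Qed.

(** On the diagonal at [z a], [F a] gives a vanishing sum of nonnegative terms. Hence some factor of
    term [j] vanishes at [z a], and [facet_unique] applies. *)
Lemma facet_slot j a : dotv (F a) (y j) != 0 -> exists l c, f j l = c *: F a.
Proof.
move=> Fy; have [_ _ za zab] := facets.
have Cz : C (z a).
  apply: F_cone => b; have [<-|ab] := eqVneq a b; first by rewrite za.
  exact/ltW/zab.
have g_ge0 i : 0 <= \prod_(l < k.+1) dotv (f i l) (z a).
  by apply: prodr_ge0 => l _; apply: f_dual.
have /eqP : dotv (F a) (reduction phi (fun _ : 'I_k.+1 => z a)) = 0.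
  by rewrite reduction_diag linearZ /= za mulr0.
rewrite reductionE linear_sum /= psumr_eq0 => [|i _]; last first.
  by rewrite linearZ /= mulr_ge0 // F_dual.
move=> /allP /(_ j (mem_index_enum _)); rewrite linearZ /= mulf_eq0 (negPf Fy) orbF.
move=> /prodf_eq0 [l _ /eqP fz]; exists l.
exact: (facet_unique facets (Fe a) (f_dual j l) fz).
Qed.

(** In a nonzero product the functional in the slot of a facet is a nonzero multiple of it, and
    distinct facets are not proportional. Facets containing [y j] get the default [ord0]. *)
Lemma slot_assignment : exists slot : J -> T -> 'I_k.+1,
  forall j (x : 'I_k.+1 -> 'rV[R]_n), \prod_l dotv (f j l) (x l) != 0 ->
    (forall a, dotv (F a) (y j) != 0 -> dotv (F a) (x (slot j a)) != 0) /\
    (forall a b, dotv (F a) (y j) != 0 -> dotv (F b) (y j) != 0 ->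
       slot j a = slot j b -> a = b).
Proof.
have /choice [s sP] (ja : J * T) : exists l, dotv (F ja.2) (y ja.1) != 0 ->
    exists c, f ja.1 l = c *: F ja.2.
  have [Fy|Fy] := eqVneq (dotv (F ja.2) (y ja.1)) 0; first by exists ord0.
  by have [l lP] := facet_slot Fy; exists l.
exists (fun j a => s (j, a)) => j x /prodf_neq0 fx.
have key a : dotv (F a) (y j) != 0 ->
    exists c, [/\ c != 0, f j (s (j, a)) = c *: F a & dotv (F a) (x (s (j, a))) != 0].
  move=> /(sP (j, a)) /= [c fE]; exists c; have := fx (s (j, a)) isT.
  by rewrite fE dotvC linearZ /= mulf_eq0 negb_or dotvC => /andP [].
split=> [a /key [c [_ _]] //|a b /key [c [c0 fa _]] /key [c' [c'0 fb _]] ab].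
have [_ _ za zab] := facets; apply/eqP; apply: contraT => /zab.
have : c *: F a = c' *: F b by rewrite -fa -fb ab.
move=> /(congr1 (dotv (z a))); rewrite !linearZ /= ![dotv (z a) _]dotvC za mulr0.
by move=> /esym /eqP; rewrite mulf_eq0 (negPf c'0) /= => /eqP ->; rewrite ltxx.
Qed.

(** * A vertex of minimal support *)

Definition facet_support (x : 'rV[R]_n) : {set T} := [set a | dotv (F a) x != 0]%SET.

Lemma minimal_support_point : exists v, [/\ C v, dotv phi v = 1 &
  forall u, C u -> facet_support u \proper facet_support v -> u = 0].
Proof.
pose P m := `[< exists x, [/\ C x, x != 0 & #|facet_support x| = m] >].
have e0 : e != 0.
  by apply: contra_eqN phie => /eqP ->; rewrite linear0 eq_sym oner_eq0.
have exP : exists m, P m by exists #|facet_support e|; apply/asboolP; exists e.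
have [m /asboolP [v [Cv v0 vm]] minm] := ex_minnP exP.
have pv := phi_gt0 Cv v0; exists ((dotv phi v)^-1 *: v); split.
- by apply: CZ => //; rewrite invr_ge0 ltW.
- by rewrite linearZ /= mulVf // gt_eqF.
have -> : facet_support ((dotv phi v)^-1 *: v) = facet_support v.
  by apply/setP => a; rewrite !inE linearZ /= mulf_eq0 invr_eq0 gt_eqF.
move=> u Cu /proper_card lt_uv; apply: contraTeq lt_uv => u0.
by rewrite -leqNgt vm minm //; apply/asboolP; exists u.
Qed.

Variable v : 'rV[R]_n.
Hypothesis Cv : C v.
Hypothesis phiv : dotv phi v = 1.
Hypothesis v_min : forall u, C u -> facet_support u \proper facet_support v -> u = 0.
Local Notation S := (facet_support v).

Lemma support_gt0 b : b \in S -> 0 < dotv (F b) v.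
Proof. by rewrite inE lt_neqAle eq_sym => ->; apply: F_dual. Qed.

Lemma notin_support b : b \notin S -> dotv (F b) v = 0.
Proof. by rewrite inE negbK => /eqP. Qed.

Lemma support_nonempty : exists b, b \in S.
Proof.
apply/set0Pn; apply/eqP => S0.
have : C (- v).
  by apply: F_cone => a; rewrite linearN /= notin_support ?oppr0 // S0 inE.
by move=> /(phi_ge0 phi_gt0); rewrite linearN /= phiv oppr_ge0 ler10.
Qed.

(** Ratio test: [t] is the least [F_b(u) / F_b(v)] over [b] in [S], attained at [b0]; the other
    [F_b] vanish at [v] and keep their values. The point [u] may lie outside [C]. *)
Lemma subtract_vertex u : (forall b, b \notin S -> 0 <= dotv (F b) u) ->
  exists t b0, [/\ b0 \in S, dotv (F b0) (u - t *: v) = 0 & C (u - t *: v)].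
Proof.
move=> Fu; have [b1 b1S] := support_nonempty.
have [b0 b0S b0min] := @arg_minP _ _ _ b1 (fun b => b \in S)
  (fun b => dotv (F b) u / dotv (F b) v) b1S.
exists (dotv (F b0) u / dotv (F b0) v), b0; split=> //.
  by rewrite linearB linearZ /= divfK ?subrr // gt_eqF // support_gt0.
apply: F_cone => b; rewrite linearB linearZ /=.
have [bS|bS] := boolP (b \in S); last by rewrite (notin_support bS) mulr0 subr0 Fu.
by rewrite subr_ge0 -ler_pdivlMr ?support_gt0 // b0min.
Qed.

(** After the ratio test the remainder lies in [C] with support strictly inside [S], so it is zero
    by minimality. *)
Lemma vertex_multiple u : (forall b, b \notin S -> dotv (F b) u = 0) ->
  u = dotv phi u *: v.
Proof.
move=> Fu; have [b /Fu ->//|t [b0 [b0S Fb0 Cu]]] := @subtract_vertex u.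
have /v_min : C (u - t *: v) by [].
have -> : facet_support (u - t *: v) \proper S.
  apply/properP; split; last by exists b0; rewrite // inE Fb0 eqxx.
  apply/fintype.subsetP => b; apply: contraTT => bS.
  by rewrite inE negbK linearB linearZ /= Fu // (notin_support bS) mulr0 subr0.
move=> /(_ isT) /eqP; rewrite subr_eq0 => /eqP ->.
by rewrite linearZ /= phiv mulr1.
Qed.

(** A surviving term on the diagonal at [v] outputs a nonzero multiple of [v], so all facets of [S]
    occupy distinct slots. *)
Lemma card_support_le : (#|S| <= k.+1)%N.
Proof.
have [b bS] := support_nonempty.
have [|j [gj Fyj]] := @term_exists (F b) (fun _ : 'I_k.+1 => v).
  by rewrite reduction_diag phiv expr1n scale1r gt_eqF // support_gt0.
have [slot /(_ _ _ gj) [slot_v slot_inj]] := slot_assignment.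
have yE : y j = dotv phi (y j) *: v.
  by apply: vertex_multiple => c; apply: contraNeq => /slot_v; rewrite inE.
have Fy c : c \in S -> dotv (F c) (y j) != 0.
  move=> cS; rewrite yE linearZ mulf_neq0 //; last by rewrite gt_eqF ?support_gt0.
  by apply: contraNneq Fyj => p0; rewrite yE p0 scale0r linear0.
rewrite -(card_in_imset (f := slot j)) => [|c c' /Fy Fc /Fy Fc']; last exact: slot_inj.
by rewrite (leq_trans (max_card _)) // card_ord.
Qed.

(** * Edges at the vertex *)

(** In a surviving term for [(e, v, ..., v)], a facet outside [S] that misses [y j] contains [v], so
    its slot is [ord0]; slots are distinct, so [a] is the only one. Subtracting a multiple of [v]
    then reaches the facet [b0]. *)
Lemma edge_exists a : a \notin S -> exists w b0,
  [/\ C w /\ dotv phi w = 1, 0 < dotv (F a) w, b0 \in S, dotv (F b0) w = 0 &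
    forall b, b \notin S -> b != a -> dotv (F b) w = 0].
Proof.
move=> aS.
have [|j [gj Fyj]] := @term_exists (F a) (fun l : 'I_k.+1 => if l == ord0 then e else v).
  rewrite reduction_slot0 // !linearZ linearD linearZ /= (notin_support aS) mulr0 addr0.
  by rewrite mulf_neq0 ?gt_eqF ?Fe // invr_gt0.
have [slot /(_ _ _ gj) [slot_v slot_inj]] := slot_assignment.
have slot0 b : b \notin S -> dotv (F b) (y j) != 0 -> slot j b = ord0.
  by move=> bS /slot_v /=; case: (eqVneq (slot j b) ord0) => //; rewrite notin_support ?eqxx.
have [|t [b0 [b0S Fb0 Cw]]] := @subtract_vertex (y j); first by move=> b _; apply: F_dual.
set w := y j - t *: v in Fb0 Cw.
have FwE b : b \notin S -> dotv (F b) w = dotv (F b) (y j).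
  by move=> bS; rewrite linearB linearZ /= (notin_support bS) mulr0 subr0.
have Faw : 0 < dotv (F a) w by rewrite FwE // lt_neqAle eq_sym Fyj F_dual.
have w0 : w != 0 by apply: contraTneq Faw => ->; rewrite linear0 ltxx.
have pw := phi_gt0 Cw w0.
exists ((dotv phi w)^-1 *: w), b0; split=> //.
- by split; [apply: CZ; rewrite ?invr_ge0 ?ltW | rewrite linearZ /= mulVf // gt_eqF].
- by rewrite linearZ mulr_gt0 // invr_gt0.
- by rewrite linearZ /= Fb0 mulr0.
move=> b bS ba; rewrite linearZ /= FwE //.
rewrite (_ : dotv (F b) (y j) = 0) ?mulr0 //.
by apply: contraNeq ba => Fb; rewrite (slot_inj _ _ Fb Fyj) // !slot0.
Qed.

Lemma edge_constant a w b0 c : a \notin S -> C w -> dotv phi w = 1 ->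
  0 < dotv (F a) w -> b0 \in S -> dotv (F b0) w = 0 ->
  (forall b, b \notin S -> b != a -> dotv (F b) w = 0) ->
  c \in S -> c != b0 -> dotv (F c) w = dotv (F c) v.
Proof.
move=> aS Cw phiw Faw b0S Fb0 Fw cS cb0.
have Fb0v := support_gt0 b0S; have Fcv := support_gt0 cS.
have [slot slotP] := slot_assignment.
(* Such a term outputs a combination of [v] and [w]. Off the facet [b0] the coefficient of [v] is
   positive, so the output also misses [c]. *)
have factor j (x : 'I_k.+1 -> 'rV[R]_n) : \prod_l dotv (f j l) (x l) != 0 ->
    (forall b l, b \notin S -> b != a -> dotv (F b) (x l) = 0) ->
    dotv (F b0) (y j) != 0 -> dotv (F c) (y j) != 0.
  move=> gj Fx Fb0y; have [slot_x _] := slotP _ _ gj.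
  pose s := dotv (F a) (y j) / dotv (F a) w.
  have s0 : 0 <= s by rewrite divr_ge0 // ?F_dual // ltW.
  have : y j - s *: w = dotv phi (y j - s *: w) *: v.
    apply: vertex_multiple => b bS; rewrite linearB linearZ /=.
    have [->|ba] := eqVneq b a; first by rewrite divfK ?subrr // gt_eqF.
    rewrite Fw // mulr0 subr0; apply/eqP; apply: contraT => /slot_x.
    by rewrite Fx ?eqxx.
  set r := dotv phi _ => /eqP; rewrite subr_eq => /eqP yE.
  have r0 : 0 < r.
    rewrite -(pmulr_lgt0 _ Fb0v).
    have : dotv (F b0) (y j) = r * dotv (F b0) v.
      by rewrite yE linearD !linearZ /= Fb0 mulr0 addr0.
    by move=> <-; rewrite lt_neqAle eq_sym Fb0y F_dual.
  rewrite yE linearD !linearZ /= gt_eqF // ltr_pwDl ?mulr_gt0 // mulr_ge0 //.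
  exact: F_dual.
have Fcw : dotv (F c) w != 0.
  apply/negP => /eqP Fcw.
  (* If [F c] vanished at [w] as [F b0] does, both would need the only slot holding [v]. *)
  have [|j [gj Fyj]] := @term_exists (F b0) (fun l : 'I_k.+1 => if l == ord0 then v else w).
    rewrite reduction_slot0 // linearZ linearD linearZ /= Fb0 mulr0 addr0.
    by rewrite mulf_neq0 ?gt_eqF // invr_gt0.
  have Fcy : dotv (F c) (y j) != 0.
    apply: (factor _ _ gj) => // b l bS ba; case: ifP => _; last exact: Fw.
    exact: notin_support.
  have [slot_x slot_inj] := slotP _ _ gj.
  have slot0 b : dotv (F b) w = 0 -> dotv (F b) (y j) != 0 -> slot j b = ord0.
    by move=> Fbw /slot_x /=; case: (eqVneq (slot j b) ord0) => //; rewrite Fbw eqxx.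
  by case/eqP: cb0; apply: slot_inj => //; rewrite !slot0.
apply/eqP; apply: contraT => Fcwv.
(* [x] is a zero of [F c] in the span of [v] and [w]. If [F c] differed at [v] and [w], then [phi]
   and [F b0] would be nonzero at [x], and a term would survive with [F c] in a slot, where it
   vanishes. *)
pose x := dotv (F c) w *: v - dotv (F c) v *: w.
have xE G : dotv G x = dotv (F c) w * dotv G v - dotv (F c) v * dotv G w.
  by rewrite linearB /=; congr (_ - _); apply: linearZ.
have [|j [gj Fyj]] := @term_exists (F b0) (fun _ : 'I_k.+1 => x).
  rewrite reduction_diag linearZ /= !xE phiv phiw Fb0 mulr0 subr0 !mulr1.
  by rewrite mulf_neq0 ?mulf_neq0 ?expf_neq0 ?subr_eq0 // gt_eqF.
have Fcy : dotv (F c) (y j) != 0.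
  apply: (factor _ _ gj) => // b _ bS ba.
  by rewrite xE (notin_support bS) (Fw b)// !mulr0 subr0.
have [slot_x _] := slotP _ _ gj; have := slot_x c Fcy.
by rewrite xE mulrC subrr eqxx.
Qed.

(** Setting [W a = v] and [beta a = a] on [S] puts each facet of [S] in its own fibre of [beta] and
    gives all facets one normalisation. *)
Lemma edges_exist : exists (W : T -> 'rV[R]_n) (beta : T -> T),
  [/\ forall a, 0 < dotv (F a) (W a) /\ dotv phi (W a) = 1,
      forall a, beta a \in S,
      forall a, a \in S -> W a = v /\ beta a = a,
      forall a b, a \notin S -> b \notin S -> b != a -> dotv (F b) (W a) = 0
    & forall a c, a \notin S -> c \in S ->
        dotv (F c) (W a) = dotv (F c) v * (c != beta a)%:R].
Proof.
have /choice [Wb WbP] (a : T) : exists wb : 'rV[R]_n * T,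
    [/\ 0 < dotv (F a) wb.1 /\ dotv phi wb.1 = 1, wb.2 \in S,
      a \in S -> wb.1 = v /\ wb.2 = a,
      forall b, a \notin S -> b \notin S -> b != a -> dotv (F b) wb.1 = 0
    & forall c, a \notin S -> c \in S ->
        dotv (F c) wb.1 = dotv (F c) v * (c != wb.2)%:R].
  have [aS|aS] := boolP (a \in S).
    by exists (v, a); split=> //; split=> //; apply: support_gt0.
  have [w [b0 [[Cw phiw] Faw b0S Fb0 Fw]]] := edge_exists aS.
  exists (w, b0); split=> //= [b _|c _ cS]; first exact: Fw.
  have [->|cb0] := eqVneq c b0; first by rewrite Fb0 mulr0.
  by rewrite mulr1; apply: (edge_constant aS Cw phiw Faw b0S Fb0 Fw cS cb0).
exists (fun a => (Wb a).1), (fun a => (Wb a).2).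
by split=> [a|a|a|a b|a c]; have [Fa beS WS F0 Fc] := WbP a => //; [apply: F0 | apply: Fc].
Qed.

(** * Product coordinates on the base *)

Lemma base_simplex_prod : exists d : 'I_#|S| -> nat,
  affinely_isomorphic (base_K C phi) (@simplex_prod R #|S| d).
Proof.
have [W [beta [FW beta_S W_S FW0 FWc]]] := edges_exist.
have [b1 b1S] := support_nonempty.
pose cls a := enum_rank_in b1S (beta a).
pose q a := (dotv (F a) (W a))^-1 *: F a.
have qE a x : dotv (q a) x = dotv (F a) x / dotv (F a) (W a).
  by rewrite [LHS]dotvC linearZ /= [dotv x _]dotvC mulrC.
have FqE a x : dotv (F a) x = dotv (q a) x * dotv (F a) (W a).
  by rewrite qE divfK // gt_eqF //; case: (FW a).
have clsE a i : (cls a == i) = (beta a == enum_val i).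
  apply/eqP/eqP => [<-|ab]; first by rewrite /cls enum_rankK_in.
  by rewrite /cls ab enum_valK_in.
have big_cls (G : T -> R) i : \sum_(a | cls a == i) G a
    = G (enum_val i) + \sum_(a | (a \notin S) && (beta a == enum_val i)) G a.
  have iS := enum_valP i; rewrite (bigD1 (enum_val i)) /=.
    congr (_ + _); apply: eq_bigl => a; rewrite clsE andbC.
    have [aS|aS] := boolP (a \in S); last first.
      by case: eqP aS => // ->; rewrite iS.
    by rewrite (W_S a aS).2; case: eqP.
  by rewrite clsE (W_S _ iS).2.
(* The point with [phi]-value [s] and coordinates [p a] for [a] outside [S]; its coordinates in [S]
   are then forced. *)
pose comb (p : T -> R) (s : R) :=
  \sum_(a | a \notin S) p a *: W a + (s - \sum_(a | a \notin S) p a) *: v.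
have combE G p s : dotv G (comb p s) = \sum_(a | a \notin S) p a * dotv G (W a)
    + (s - \sum_(a | a \notin S) p a) * dotv G v.
  rewrite linearD linear_sum /=; congr (_ + _); last exact: linearZ.
  by apply: eq_bigr => a _; apply: linearZ.
have phi_comb p s : dotv phi (comb p s) = s.
  rewrite combE phiv mulr1; under eq_bigr do rewrite (FW _).2 mulr1.
  by rewrite addrC subrK.
have F_comb b p s : b \notin S -> dotv (F b) (comb p s) = p b * dotv (F b) (W b).
  move=> bS; rewrite combE (notin_support bS) mulr0 addr0 (bigD1 b) //=.
  rewrite big1 ?addr0 // => a /andP [aS ab]; rewrite FW0 ?mulr0 // eq_sym.
  exact: ab.
have F_comb_S b p s : b \in S -> dotv (F b) (comb p s)
    = (s - \sum_(a | (a \notin S) && (beta a == b)) p a) * dotv (F b) v.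
  move=> bS; rewrite combE (eq_bigr (fun a => (p a * (b != beta a)%:R) * dotv (F b) v)).
    rewrite -mulr_suml -mulrDl; congr (_ * _).
    rewrite addrCA; congr (_ + _).
    rewrite (bigID (fun a => beta a == b)) /= [X in _ - X](bigID (fun a => beta a == b)) /=.
    rewrite big1 ?add0r => [|a /andP [_ /eqP ->]]; last by rewrite eqxx /= mulr0.
    rewrite opprD addrCA [X in _ + (X - _)](eq_bigr p) ?subrr ?addr0 //.
    by move=> a /andP [_]; rewrite eq_sym => ->; rewrite mulr1.
  by move=> a aS; rewrite FWc // mulrCA mulrC.
(* Both sides agree under [phi] and all facets outside [S], so [vertex_multiple] makes the
   difference zero. *)
have decomposition x : x = comb (fun a => dotv (q a) x) (dotv phi x).
  apply/eqP; rewrite -subr_eq0; apply/eqP.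
  rewrite [LHS]vertex_multiple => [|b bS].
    by rewrite linearB /= phi_comb subrr scale0r.
  by rewrite linearB /= F_comb // FqE subrr.
have q_S b x : b \in S -> dotv (q b) x
    = dotv phi x - \sum_(a | (a \notin S) && (beta a == b)) dotv (q a) x.
  move=> bS; rewrite qE {1}[x]decomposition F_comb_S // (W_S b bS).1 mulfK //.
  by rewrite gt_eqF // support_gt0.
apply: (simplex_coordinates_iso (cls := cls) (q := q)).
- move=> i; exists (enum_val i); apply/eqP.
  by rewrite clsE (W_S _ (enum_valP i)).2.
- by move=> x a [Cx _]; rewrite qE; apply: divr_ge0; [apply: F_dual | case: (FW a) => /ltW].
- by move=> x i [_ phix]; rewrite big_cls q_S ?enum_valP // phix subrK.
- move=> x x' [_ phix] [_ phix'] xx'; rewrite [x]decomposition [x']decomposition.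
  by rewrite phix phix'; congr (comb _ _); apply/funext.
move=> p p_ge0 p_sum; pose x := comb p 1.
have qx a : dotv (q a) x = p a.
  have q_notin b : b \notin S -> dotv (q b) x = p b.
    by move=> bS; rewrite qE F_comb // mulfK // gt_eqF //; case: (FW b).
  have [aS|/q_notin //] := boolP (a \in S).
  have aE : enum_val (cls a) = a by rewrite /cls enum_rankK_in ?(W_S _ aS).2.
  have := p_sum (cls a); rewrite big_cls aE => p1.
  rewrite q_S // (phi_comb p 1) -p1.
  under [X in _ - X]eq_bigr => b /andP [bS _] do rewrite q_notin //.
  by rewrite addrK.
exists x; split=> //; split; last exact: phi_comb.
apply: F_cone => a; rewrite FqE qx mulr_ge0 // ltW //; by case: (FW a).
Qed.
End ToSimplices.

(** * The equivalence *)

Theorem theorem2 (R : realType) (n : nat) (C : set 'rV[R]_n)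
  (phi : 'rV[R]_n) (k : nat) :
  (0 < n)%N ->
  proper_cone C ->
  interior (dual_cone C) phi ->
  (0 < k)%N ->
  (@entanglement_breaking R n k C phi <->
   exists (m : nat) (d : 'I_m -> nat),
     (m <= k)%N /\ affinely_isomorphic (base_K C phi) (@simplex_prod R m d)).
Proof.
move=> n0 [[C0 CD] CZ _ _ C_spans] phi_int; case: k => // k _.
have phi_gt0 x : C x -> x != 0 -> 0 < dotv phi x by apply: dual_interior_gt0.
split=> [/(entanglement_breakingP _ _ C0 CZ) [J [f [y [f_dual yC redE]]]]|]; last first.
  move=> [m [d [le_mk iso]]].
  exact: (simplex_prod_entanglement_breaking C_spans C0 CD CZ phi_gt0 le_mk iso).
have [e [Ce phie fe]] := strictly_positive_point C_spans C0 CD CZ phi_gt0 f_dual n0.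
(* Zero functionals are dropped, since [facets_exist] asks for strict positivity at [e]. *)
pose I : finType := {i : J * 'I_k.+1 | f i.1 i.2 != 0}.
have [||x fx|T [F [z [facets Fe]]]] :=
    @facets_exist R n C I (fun i => f (val i).1 (val i).2) e.
- by move=> i; apply: f_dual.
- by move=> i; apply: fe; apply: (valP i).
- apply: (cone_of_factors C0 CD CZ phi_gt0 f_dual yC redE Ce phie) => j l.
  have [->|fjl] := eqVneq (f j l) 0; first by rewrite dotvC linear0.
  exact: (fx (exist _ (j, l) fjl)).
have [v [Cv phiv v_min]] := minimal_support_point CZ phi_gt0 F Ce phie.
have [d iso] := base_simplex_prod CZ phi_gt0 f_dual yC redE facets Fe Cv phiv v_min.
exists #|facet_support F v|, d; split=> //.
exact: (card_support_le phi_gt0 f_dual yC redE facets Fe Cv phiv v_min).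
Qed.
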